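(* Let $k\ge 1$ be an integer and let $C_0,c_0>0$. There exist constants $C,c>0$, depending only on $k,C_0,c_0$ (and, for fixed $C_0,c_0$, at most polynomially on $2^k$), such that the following holds. Let $\mathbb{F}$ be a field, let $A\subseteq\mathbb{F}$ be a finite set with $|A|\ge 2$ and $|AA|\le M|A|$, let $\Delta>0$ be a real number, and let $P\subseteq A-A$ be a set such that $\Delta\le r_{A-A}(x)\le 2\Delta$ for all $x\in P$ and $$\mathsf{E}^{+}_k(A)\le C_0(\log|A|)^{c_0}\sum_{x\in P} r_{A-A}(x)^k .$$ Then $$|PA|\le C(\log|A|)^{c}\,M^{6k}\,|P| .$$
   Context: For finite sets $X,Y$ in a field: $XY=\{xy: x\in X,y\in Y\}$, $A-A=\{a-b: a,b\in A\}$, and $r_{A-A}(x)=|\{(a,b)\in A^2: a-b=x\}|$. For an integer $k\ge 2$, $\mathsf{E}^{+}_k(A)=|\{(a_1,\dots,a_k,a_1',\dots,a_k')\in A^{2k}: a_1-a_1'=\dots=a_k-a_k'\}|=\sum_x r_{A-A}(x)^k$, and $\mathsf{E}^{+}_1(A)=|A|^2$. Logarithms are to base $2$. *)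

(* Defs.v *)
From mathcomp Require Import all_boot all_order all_algebra finmap.
From mathcomp Require Import reals exp.

Set Implicit Arguments.
Unset Strict Implicit.
Unset Printing Implicit Defensive.

Import GRing.Theory.

Local Open Scope fset_scope.
Local Open Scope ring_scope.

Definition prodset (F : fieldType) (X Y : {fset F}) : {fset F} :=
  [fset x * y | x in X, y in Y].

Definition diffset (F : fieldType) (X Y : {fset F}) : {fset F} :=
  [fset x - y | x in X, y in Y].

Definition rdiff (F : fieldType) (A : {fset F}) (x : F) : nat :=
  #|` [fset u in A `*` A | u.1 - u.2 == x]|.

(* The number of 2k-tuples (a_1, ..., a_k, a'_1, ..., a'_k) of elements of A
   with a_1 - a'_1 = ... = a_k - a'_k.  For k = 1 the condition is void and the
   count is |A|^2, see energy1. *)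
Definition energy (F : fieldType) (A : {fset F}) (k : nat) : nat :=
  #|[set u : {ffun 'I_k -> A} * {ffun 'I_k -> A} |
      [forall i, forall j,
         val (u.1 i) - val (u.2 i) == val (u.1 j) - val (u.2 j)]]|.

Definition log2 (R : realType) (x : R) : R := ln x / ln 2.

Lemma energy1 (F : fieldType) (A : {fset F}) : energy A 1 = (#|` A| ^ 2)%N.
Proof.
rewrite /energy (_ : [set u | _] = [set: _]).
  by rewrite cardsT card_prod card_ffun card_ord expn1 -cardfE mulnn.
apply/setP => u; rewrite !inE; apply/forallP => i; apply/forallP => j.
by rewrite (ord1 i) (ord1 j).
Qed.

Lemma rdiff_card (F : fieldType) (A : {fset F}) (x : F) :
  rdiff A x = #|[pred w : A * A | val w.1 - val w.2 == x]|.
Proof.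
rewrite /rdiff.
have -> : [fset u in A `*` A | u.1 - u.2 == x] =
    [fset (val w.1, val w.2) |
       w in [pred w : A * A | val w.1 - val w.2 == x]].
  apply/fsetP => -[a b]; rewrite !inE /=; apply/idP/imfsetP => /=.
    case/andP=> /andP[aA bA] e.
    by exists ([` aA], [` bA]); rewrite ?inE.
  by case=> -[c d] /= e [-> ->]; rewrite !fsvalP; exact: e.
rewrite card_imfset /=; first by rewrite cardE.
by move=> [a b] [c d] /= [/val_inj -> /val_inj ->].
Qed.

Lemma energyE (F : fieldType) (A : {fset F}) (k : nat) : (0 < k)%N ->
  energy A k = (\sum_(x <- diffset A A) rdiff A x ^ k)%N.
Proof.
case: k => // k _.
pose f (w : {ffun 'I_k.+1 -> A * A}) :=
  ([ffun i => (w i).1] : {ffun 'I_k.+1 -> A},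
   [ffun i => (w i).2] : {ffun 'I_k.+1 -> A}).
have f_inj : injective f.
  move=> w w' [] /ffunP e1 /ffunP e2; apply/ffunP => i.
  by move: (e1 i) (e2 i); rewrite !ffunE; case: (w i) (w' i) => ? ? [? ?] /= -> ->.
pose D (p : A * A) : F := val p.1 - val p.2.
pose S := [set w : {ffun 'I_k.+1 -> A * A} | [forall i, D (w i) == D (w ord0)]].
have -> : energy A k.+1 = #|S|.
  rewrite /energy -(card_imset _ f_inj); apply: eq_card => -[u v].
  rewrite inE; apply/idP/imsetP => /=.
    move=> /forallP h; exists [ffun i => (u i, v i)].
      by rewrite inE; apply/forallP => i; rewrite !ffunE; exact: (forallP (h i)).
    by congr pair; apply/ffunP => i; rewrite !ffunE.
  case=> w; rewrite inE => /forallP h [-> ->].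
  apply/forallP => i; apply/forallP => j; rewrite !ffunE.
  by rewrite -/(D (w i)) -/(D (w j)) (eqP (h i)) (eqP (h j)).
have DA p : D p \in diffset A A by apply/imfset2P; exists (val p.1); rewrite ?fsvalP //;
   exists (val p.2); rewrite ?fsvalP.
rewrite -sum1_card (partition_big (fun w : {ffun _ -> _} => [` DA (w ord0)]) xpredT) //=.
rewrite big_seq_fsetE /=; apply: eq_bigr => x _.
rewrite rdiff_card -[X in (_ ^ X)%N]card_ord -card_ffun_on sum1_card.
apply: eq_card => w; rewrite [LHS]inE /= inE -(inj_eq val_inj) /=.
apply/andP/ffun_onP => /= [[/forallP h /eqP <-] i|h]; first by rewrite inE; exact: h.
have e i : D (w i) = val x by move: (h i); rewrite inE => /eqP.
by split; [apply/forallP => i; rewrite !e | rewrite e].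
Qed.

(* Main.v *)
Require Import Defs.
From mathcomp Require Import all_boot all_order all_algebra finmap.
From mathcomp Require Import reals sequences exp zify ring lra.

(** Why the bound holds.  If [p] is a popular difference of [A], say [p = b - c]
    in at least [Delta] ways, then [p * a = a * b - a * c] shows that every
    element of [PA] is at least as popular as a difference of [AA].  Counting
    [k]-th powers of multiplicities, [#PA * Delta ^ k] is therefore at most the
    [k]-th energy of [AA].  So it suffices to bound the energy of [AA] by that
    of [A]: the hypothesis on [P] bounds the latter by
    [C0 (log #A) ^ c0 (2 Delta) ^ k #P], and [Delta ^ k] cancels.

    The energies are compared by covering [AA] with few dilates of [A].  Away
    from [0], the inequality of Pluennecke and Ruzsa, in Petridis' form
    ([plunnecke_ruzsa]), bounds [#(AA/A)] by about [M ^ 3 #A].  Each [z] in [AA]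
    lies in exactly [#A] of the dilates [xA] with [x] in [AA/A], so a greedy
    choice covers [AA] by a set [X] of [O (M ^ 3 log #A)] dilates
    ([few_dilates]).

    The multiplicity of [z] as a difference of [AA] is then at most the sum over
    [x, y] in [X] of the number of solutions of [x b - y c = z].  The power mean
    inequality costs a factor [#X ^ (2 k - 2)], and each of the [#X ^ 2] pairs
    contributes at most the energy of [A] ([dilate_energy]): equality of all the
    [x b_i - y c_i] means [x (b_i - b_j) = y (c_i - c_j)], and the number of
    coincidences of two functions is at most the mean of the numbers of
    self-coincidences.  The total loss [#X ^ (2 k)] is [M ^ (6 k)] up to
    constants and logarithms. *)

Set Implicit Arguments.
Unset Strict Implicit.
Unset Printing Implicit Defensive.

Import Order.TTheory GRing.Theory Num.Theory.

Local Open Scope fset_scope.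
Local Open Scope ring_scope.

(** * Energies of unions of dilates *)

Lemma rearrangement_pow (a b k : nat) :
  (a * b ^ k + b * a ^ k <= a ^ k.+1 + b ^ k.+1)%N.
Proof.
wlog le_ab : a b / (a <= b)%N.
  by move=> W; case: (leqP a b) => [|/ltnW] /W //; rewrite addnC [X in (_ <= X)%N]addnC.
have le_k : (a ^ k <= b ^ k)%N by case: k => // k; rewrite leq_exp2r.
rewrite !expnS; nia.
Qed.

(** Induction on the exponent through Chebyshev's sum inequality
    [(sum f) (sum f ^ k) <= #I (sum f ^ k.+1)]: doubled and written as a double
    sum, it is [rearrangement_pow] term by term. *)
Lemma power_mean (I : finType) (f : I -> nat) (k : nat) :
  ((\sum_i f i) ^ k.+1 <= #|I| ^ k * \sum_i f i ^ k.+1)%N.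
Proof.
elim: k => [|k IH]; first by rewrite expn0 mul1n expn1.
rewrite expnS; apply: (leq_trans (leq_mul (leqnn _) IH)).
rewrite mulnCA expnSr -mulnA leq_mul2l; apply/orP; right.
rewrite -(leq_pmul2l (isT : 0 < 2)%N).
have -> : (2 * ((\sum_i f i) * \sum_i f i ^ k.+1))%N =
    (\sum_i \sum_j (f i * f j ^ k.+1 + f j * f i ^ k.+1))%N.
  rewrite mul2n -addnn {1}big_distrlr /= mulnC big_distrlr /= -big_split /=.
  apply: eq_bigr => i _; rewrite -big_split /=; apply: eq_bigr => j _.
  by rewrite (mulnC (f i ^ _)%N).
have -> : (2 * (#|I| * \sum_i f i ^ k.+2))%N =
    (\sum_i \sum_j (f i ^ k.+2 + f j ^ k.+2))%N.
  under [RHS]eq_bigr => i _ do rewrite big_split /= sum_nat_const.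
  by rewrite big_split /= sum_nat_const -big_distrr /= addnn mul2n.
by apply: leq_sum => i _; apply: leq_sum => j _; exact: rearrangement_pow.
Qed.

(** With [a v] and [b v] the sizes of the fibers of [f] and [g] over [v], the three
    counts are the sums of [a v * b v], [a v ^ 2] and [b v ^ 2]. *)
Lemma coincidence_amgm (T : finType) (V : eqType) (f g : T -> V) :
  (2 * #|[pred w : T * T | f w.1 == g w.2]| <=
     #|[pred w : T * T | f w.1 == f w.2]| + #|[pred w : T * T | g w.1 == g w.2]|)%N.
Proof.
pose s := undup (codom f ++ codom g).
have fs t : f t \in s by rewrite mem_undup mem_cat codom_f.
have gs t : g t \in s by rewrite mem_undup mem_cat codom_f orbT.
have E (a b : T -> V) : (forall t, a t \in s) ->
    #|[pred w : T * T | a w.1 == b w.2]| =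
    (\sum_(v <- s) #|[pred t | a t == v]| * #|[pred t | b t == v]|)%N.
  move=> as_; rewrite -sum1_card big_mkcond /=.
  under [RHS]eq_bigr => v _.
    rewrite -!sum1_card big_mkcond /= [X in (_ * X)%N]big_mkcond /=.
    rewrite big_distrlr /= pair_bigA /=.
  over.
  rewrite exchange_big /=; apply: eq_bigr => -[t u] _ /=.
  rewrite !inE /= (bigD1_seq (a t)) ?undup_uniq //= !inE eqxx mul1n eq_sym.
  rewrite big1 ?addn0 // => v; rewrite inE eq_sym.
  by move=> /negbTE ->.
rewrite !E // -big_split big_distrr /=; apply: leq_sum => v _.
by rewrite !mulnn; exact: nat_Cauchy.
Qed.

(** The [k.+1]-st power of the size of a fiber counts the [k.+1]-tuples in that
    fiber, and a nonempty tuple determines the fiber it lies in. *)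
Lemma sum_fiber_pow (T : finType) (V : choiceType) (D : T -> V) (S : {fset V}) (k : nat) :
  (\sum_(z <- S) #|[pred t | D t == z]| ^ k.+1 <=
   #|[pred w : {ffun 'I_k.+1 -> T} | [forall i, forall j, D (w i) == D (w j)]]|)%N.
Proof.
have E z : (#|[pred t | D t == z]| ^ k.+1)%N =
    #|[pred w : {ffun 'I_k.+1 -> T} | [forall i, D (w i) == z]]|.
  rewrite -[X in (_ ^ X)%N]card_ord -card_ffun_on; apply: eq_card => w.
  by apply/ffun_onP/forallP.
under eq_bigr => z _ do rewrite E -sum1_card big_mkcond /=.
rewrite exchange_big /= -sum1_card [X in (_ <= X)%N]big_mkcond /=.
apply: leq_sum => w _; case: ifPn => [_|ncw].
  have [wS|wS] := boolP (D (w ord0) \in S).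
    rewrite (big_rem (D (w ord0))) //= big_seq big1 ?addn0; first by case: ifP.
    move=> z; rewrite mem_rem_uniq ?fset_uniq // !inE => /andP[zw _].
    by case: forallP => // /(_ ord0); rewrite eq_sym (negbTE zw).
  rewrite big_seq big1 // => z zS; rewrite inE; case: forallP => // /(_ ord0) /eqP e.
  by rewrite -e (negbTE wS) in zS.
rewrite big1 // => z _; rewrite inE; case: forallP => // h.
case/negP: ncw; rewrite inE; apply/forallP => i; apply/forallP => j.
by rewrite (eqP (h i)) (eqP (h j)).
Qed.

(** The multiplicity of [z] as a difference of the dilates [xA] and [yA]. *)
Definition rdilate (F : fieldType) (A : {fset F}) (x y z : F) : nat :=
  #|[pred w : A * A | x * val w.1 - y * val w.2 == z]|.

(** Dilating does not change the energy, and the mixed energy of two dilates is at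
    most the mean of their energies: [coincidence_amgm] is applied to the
    functions sending a tuple [u] to all the [x (u_i - u_j)], resp.
    [y (u_i - u_j)]. *)
Lemma dilate_energy (F : fieldType) (A S : {fset F}) (x y : F) (k : nat) :
  x != 0 -> y != 0 -> (0 < k)%N ->
  (\sum_(z <- S) rdilate A x y z ^ k <= energy A k)%N.
Proof.
case: k => // k x0 y0 _.
pose d c (u : {ffun 'I_k.+1 -> A}) : {ffun 'I_k.+1 * 'I_k.+1 -> F} :=
  [ffun p => c * (val (u p.1) - val (u p.2))].
have dE c : c != 0 -> #|[pred w : {ffun 'I_k.+1 -> A} * {ffun 'I_k.+1 -> A} |
    d c w.1 == d c w.2]| = energy A k.+1.
  move=> c0; apply: eq_card => -[u v]; rewrite !inE /=.
  apply/eqP/forallP => [/ffunP h i|h].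
    apply/forallP => j; move: (h (i, j)); rewrite !ffunE /= => /(mulfI c0) e.
    rewrite -subr_eq0; apply/eqP; move/eqP: e; rewrite -subr_eq0 => /eqP <-; ring.
  apply/ffunP => -[i j]; rewrite !ffunE /=; congr (_ * _).
  move/forallP: (h i) => /(_ j) /eqP e; apply/eqP; rewrite -subr_eq0; apply/eqP.
  move/eqP: e; rewrite -subr_eq0 => /eqP <-; ring.
have := coincidence_amgm (d x) (d y); rewrite !dE // addnn -mul2n leq_pmul2l //.
apply: leq_trans.
apply: leq_trans (sum_fiber_pow _ _ _) _.
pose h (w : {ffun 'I_k.+1 -> A * A}) :=
  ([ffun i => (w i).1] : {ffun 'I_k.+1 -> A}, [ffun i => (w i).2] : {ffun 'I_k.+1 -> A}).
have h_inj : injective h.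
  move=> w w' [] /ffunP e1 /ffunP e2; apply/ffunP => i.
  by move: (e1 i) (e2 i); rewrite !ffunE; case: (w i) (w' i) => ? ? [? ?] /= -> ->.
rewrite -(card_imset _ h_inj); apply: subset_leq_card; apply/subsetP => _ /imsetP[w + ->].
rewrite !inE /= => /forallP hw; apply/eqP/ffunP => -[i j]; rewrite !ffunE /=.
move/forallP: (hw i) => /(_ j) /eqP e; apply/eqP; rewrite -subr_eq0; apply/eqP.
move/eqP: e; rewrite -subr_eq0 => /eqP <-; ring.
Qed.

(** The inner sum bounds the multiplicity of [z] as a difference of the union of the
    dilates [xA], for [x] in [X]; so the left-hand side dominates what [S]
    contributes to the energy of that union.  The exponent [2 * k] is
    [2 * (k - 1)] from the power mean inequality and [2] from the number of pairs. *)
Lemma cover_energy (F : fieldType) (A S X : {fset F}) (k : nat) :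
  0 \notin X -> (0 < k)%N ->
  (\sum_(z <- S) (\sum_(c : X * X) rdilate A (val c.1) (val c.2) z) ^ k <=
     #|` X| ^ (2 * k) * energy A k)%N.
Proof.
case: k => // k X0 _.
have X0' (x : X) : val x != 0 by apply: contraNneq X0 => <-; exact: fsvalP.
apply: (@leq_trans (\sum_(z <- S) #|{: X * X}| ^ k *
    \sum_(c : X * X) rdilate A (val c.1) (val c.2) z ^ k.+1)%N).
  by apply: leq_sum => z _; exact: power_mean.
rewrite -big_distrr /= exchange_big /=.
rewrite expnM -mulnn cardfE -card_prod expnSr -mulnA leq_mul2l -sum_nat_const.
by apply/orP; right; apply: leq_sum => c _; rewrite dilate_energy ?X0'.
Qed.

(** * Growth of product sets *)

Definition quotset (F : fieldType) (X Y : {fset F}) : {fset F} :=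
  [fset x / y | x in X, y in Y].

Lemma mem_prodset (F : fieldType) (X Y : {fset F}) x y :
  x \in X -> y \in Y -> x * y \in prodset X Y.
Proof. by move=> xX yY; apply/imfset2P; exists x => //; exists y. Qed.

Lemma prodsetP (F : fieldType) (X Y : {fset F}) z :
  reflect (exists x y, [/\ x \in X, y \in Y & z = x * y]) (z \in prodset X Y).
Proof.
apply: (iffP idP) => [/imfset2P[x xX [y yY ->]]|[x [y [xX yY ->]]]].
  by exists x, y.
exact: mem_prodset.
Qed.

Lemma prodsetC (F : fieldType) (X Y : {fset F}) : prodset X Y = prodset Y X.
Proof.
by apply/fsetP => z; apply/prodsetP/prodsetP => -[x [y [xX yY ->]]];
  exists y, x; rewrite mulrC.
Qed.

Lemma prodsetA (F : fieldType) (X Y Z : {fset F}) :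
  prodset X (prodset Y Z) = prodset (prodset X Y) Z.
Proof.
apply/fsetP => w; apply/prodsetP/prodsetP.
  case=> x [_ [xX /prodsetP[y [z [yY zZ ->]]] ->]].
  by exists (x * y), z; rewrite mem_prodset // mulrA.
case=> _ [z [/prodsetP[x [y [xX yY ->]]] zZ ->]].
by exists x, (y * z); rewrite mem_prodset // mulrA.
Qed.

Lemma prodsetSS (F : fieldType) (X X' Y Y' : {fset F}) :
  X `<=` X' -> Y `<=` Y' -> prodset X Y `<=` prodset X' Y'.
Proof.
move=> /fsubsetP sX /fsubsetP sY; apply/fsubsetP => _ /prodsetP[x [y [/sX xX /sY yY ->]]].
exact: mem_prodset.
Qed.

Lemma card_dilate (F : fieldType) (X : {fset F}) c :
  c != 0 -> #|` [fset c * x | x in X]| = #|` X|.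
Proof. by move=> c0; rewrite card_imfset //; exact: mulfI. Qed.

Lemma card_prodset_le (F : fieldType) (X Y : {fset F}) :
  (#|` prodset X Y| <= #|` X| * #|` Y|)%N.
Proof.
have -> : prodset X Y = [fset val w.1 * val w.2 | w in {: X * Y}].
  apply/fsetP => z; apply/prodsetP/imfsetP => /=.
    by case=> x [y [xX yY ->]]; exists ([` xX], [` yY]).
  by case=> -[x y] _ ->; exists (val x), (val y); rewrite !fsvalP.
rewrite !cardfE -card_prod [X in (_ <= X)%N]cardT -cardfE; exact: leq_imfset_card.
Qed.

(** The inequality of Petridis: if [X] minimizes the expansion ratio [#XB / #X]
    among its own subsets, then [#CXB / #CX] is at most that ratio for every [C].
    The proof is by induction on [C].  When [c] is added to a set
    [C'], the new part of [cX] misses [cW], where [W] is the set of [x] with [cx]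
    in [C'X], and the new part of [cXB] misses [cWB]; minimality applied to [W]
    compares the two. *)
Lemma petridis (F : fieldType) (X B C : {fset F}) :
  0 \notin C ->
  (forall Z, Z `<=` X ->
     #|` prodset X B| * #|` Z| <= #|` prodset Z B| * #|` X|)%N ->
  (#|` prodset C (prodset X B)| * #|` X| <= #|` prodset C X| * #|` prodset X B|)%N.
Proof.
move=> C0 minX; elim/finSet_rect: C C0 => C IH C0.
have [->|[c cC]] := fset_0Vmem C.
  suff -> : prodset fset0 (prodset X B) = fset0 by rewrite cardfs0.
  by apply/fsetP => z; rewrite inE; apply/negP => /prodsetP[x [y []]]; rewrite inE.
pose C' := C `\ c.
have c0 : c != 0 by apply: contraNneq C0 => <-.
have C'0 : 0 \notin C' by rewrite inE negb_and C0 orbT.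
have /IH/(_ C'0) {}IH : C' `<` C by rewrite fproperD1.
pose W := [fset x in X | c * x \in prodset C' X].
have WX : W `<=` X by apply/fsubsetP => x; rewrite inE => /andP[].
have E1 : (#|` prodset C (prodset X B)| + #|` prodset W B| <=
           #|` prodset C' (prodset X B)| + #|` prodset X B|)%N.
  have sWX := prodsetSS WX (fsubset_refl B).
  rewrite -(card_dilate (prodset X B) c0) -(card_dilate (prodset W B) c0).
  set dX := [fset _ | _ in prodset X B]; set dW := [fset _ | _ in prodset W B].
  have sd : dW `<=` dX.
    apply/fsubsetP => _ /imfsetP[z /= zW ->]; apply/imfsetP; exists z => //.
    exact: (fsubsetP sWX).
  rewrite -(cardfsID dW dX) (fsetIidPr sd).
  rewrite addnA [X in (_ <= X)%N]addnAC leq_add2r.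
  apply: leq_trans (leq_card_fsetU _ _); apply: fsubset_leq_card.
  apply/fsubsetP => _ /prodsetP[e [_ [eC /prodsetP[x [b [xX bB ->]]] ->]]].
  rewrite !inE.
  have [ec|ec] := eqVneq e c; last by rewrite mem_prodset ?mem_prodset // !inE ec.
  rewrite ec; have [/imfsetP[_ /= /prodsetP[x1 [b1 [x1W b1B ->]]] ->]|_] :=
    boolP (c * (x * b) \in dW).
    by move: x1W; rewrite inE => /andP[_ cx1]; rewrite mulrA prodsetA mem_prodset.
  by apply/orP; right; apply/imfsetP; exists (x * b) => //=; exact: mem_prodset.
(* For [CX] the overlap is exactly [cW], so this is inclusion-exclusion. *)
have E2 : (#|` prodset C' X| + #|` X| <= #|` prodset C X| + #|` W|)%N.
  rewrite -(card_dilate X c0) -(card_dilate W c0).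
  set dX := [fset _ | _ in X]; set dW := [fset _ | _ in W].
  have -> : dW = prodset C' X `&` dX.
    apply/fsetP => z; rewrite inE; apply/imfsetP/andP => /=.
      case=> x; rewrite inE => /andP[xX xW] ->; split=> //.
      by apply/imfsetP; exists x.
    by case=> zC /imfsetP[x /= xX zE]; exists x; rewrite //= inE; apply/andP; rewrite /= -zE.
  rewrite -cardfsUI leq_add2r; apply: fsubset_leq_card.
  apply/fsubsetP => z; rewrite inE => /orP[|/imfsetP[x /= xX ->]].
    by apply/fsubsetP; rewrite prodsetSS // fsubD1set.
  exact: mem_prodset.
have := minX W WX; nia.
Qed.

(** Descent: as long as some subset has a smaller expansion ratio, pass to it. *)
Lemma exists_minimal_ratio (F : fieldType) (A B : {fset F}) : A != fset0 ->
  exists X, [/\ X `<=` A, X != fset0,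
    (#|` prodset X B| * #|` A| <= #|` prodset A B| * #|` X|)%N &
    forall Z, Z `<=` X ->
     (#|` prodset X B| * #|` Z| <= #|` prodset Z B| * #|` X|)%N].
Proof.
elim/finSet_rect: A => A IH A0.
pose good (Z : {fset F}) := (#|` prodset A B| * #|` Z| <= #|` prodset Z B| * #|` A|)%N.
have [h|bad] := boolP (all good (fpowerset A)).
  exists A; split=> // Z ZA; apply: (allP h Z); rewrite fpowersetE; exact: ZA.
have [Z] := allPn bad.
rewrite fpowersetE /good -ltnNge => ZA {}bad.
have Z0 : Z != fset0.
  by apply: contraTneq bad => ->; rewrite cardfs0 muln0 ltn0.
have ZA' : Z `<` A.
  rewrite fproperEneq ZA andbT; apply: contraTneq bad => ->; by rewrite ltnn.
have [X [XZ X0 le_XZ minX]] := IH Z ZA' Z0.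
exists X; split=> //; first exact: fsubset_trans XZ ZA.
have : (0 < #|` Z|)%N by rewrite cardfs_gt0.
move=> Zgt; rewrite -(leq_pmul2r Zgt) mulnAC.
apply: leq_trans (leq_mul le_XZ (leqnn _)) _.
by rewrite mulnAC [X in (_ <= X)%N]mulnAC leq_mul2r ltnW ?orbT.
Qed.

(** Fix a representation [q = y / z] of each quotient.  The map sending [(q, x)] to
    [(y x, z x)] is injective: the ratio of the images gives back [q], hence [z],
    and then [z x] gives back [x]. *)
Lemma ruzsa_triangle (F : fieldType) (X Y Z : {fset F}) : 0 \notin X -> 0 \notin Z ->
  (#|` quotset Y Z| * #|` X| <= #|` prodset Y X| * #|` prodset Z X|)%N.
Proof.
move=> X0 Z0.
have rep (q : quotset Y Z) : exists w : Y * Z, val q == val w.1 / val w.2.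
  have /imfset2P[y yY [z zZ e]] := fsvalP q.
  by exists ([` yY], [` zZ]); rewrite /= e.
have YX (q : quotset Y Z) (x : X) : val (xchoose (rep q)).1 * val x \in prodset Y X.
  by rewrite mem_prodset ?fsvalP.
have ZX (q : quotset Y Z) (x : X) : val (xchoose (rep q)).2 * val x \in prodset Z X.
  by rewrite mem_prodset ?fsvalP.
pose h (u : quotset Y Z * X) := ([` YX u.1 u.2], [` ZX u.1 u.2]).
rewrite !cardfE -!card_prod; apply: (@leq_card _ _ h).
move=> [q x] [q' x'] [e1 e2].
have x0 (t : X) : val t != 0 by apply: contraNneq X0 => <-; exact: fsvalP.
have eq : q = q'.
  apply: val_inj; rewrite (eqP (xchooseP (rep q))) (eqP (xchooseP (rep q'))).
  rewrite -[LHS]mulr1 -(divff (x0 x)) mulrACA -invfM e1 e2.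
  by rewrite invfM mulrACA divff ?mulr1 ?x0.
congr pair => //; apply: val_inj; move: e2; rewrite -{}eq; apply: mulfI.
by apply: contraNneq Z0 => <-; exact: fsvalP.
Qed.

(** Take [X] in [A] of minimal expansion ratio [r = #XA / #X], which is at most
    [#AA / #A].  By Petridis [#AAX <= r #AX = r ^ 2 #X], and the triangle
    inequality through [X] gives [#(AA/A) <= #AAX #AX / #X <= r ^ 3 #X]. *)
Lemma plunnecke_ruzsa (F : fieldType) (A : {fset F}) : 0 \notin A -> A != fset0 ->
  (#|` quotset (prodset A A) A| * #|` A| ^ 2 <= #|` prodset A A| ^ 3)%N.
Proof.
move=> A0 An0.
have [X [XA X0 le_XA minX]] := exists_minimal_ratio A An0.
have := petridis A0 minX.
have zX : 0 \notin X by apply: contra A0; exact: (fsubsetP XA).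
have := ruzsa_triangle (prodset A A) zX A0.
have leXA := fsubset_leq_card XA.
have Xgt : (0 < #|` X|)%N by rewrite cardfs_gt0.
have Agt : (0 < #|` A|)%N by rewrite cardfs_gt0.
rewrite (prodsetC A X) (prodsetC _ X) prodsetA (prodsetC X A) -prodsetA.
rewrite (prodsetC A X).
move: #|` quotset _ _| #|` X| #|` A| #|` prodset A A| #|` prodset X A|
  #|` prodset A (prodset X A)| le_XA leXA Xgt Agt => q x a s y t.
move=> le_ya le_xa xgt agt le_q le_t.
have le1 : (q * x ^ 2 <= y ^ 3)%N.
  rewrite !expnS expn0 !muln1 mulnA (leq_trans (leq_mul le_q (leqnn x))) //.
  by rewrite mulnAC [X in (_ <= X)%N]mulnA leq_mul2r le_t orbT.
have le2 : (y ^ 3 * a ^ 3 <= s ^ 3 * x ^ 3)%N by rewrite -!expnMn leq_exp2r.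
have le3 : (q * a ^ 3 <= s ^ 3 * x)%N.
  rewrite -(leq_pmul2r (_ : 0 < x ^ 2)%N) ?expn_gt0 ?xgt //.
  rewrite mulnAC -[X in (_ <= X)%N]mulnA -expnS (leq_trans _ le2) //.
  by rewrite leq_mul2r le1 orbT.
rewrite -(leq_pmul2r agt) -mulnA -expnSr (leq_trans le3) //.
by rewrite leq_mul2l le_xa orbT.
Qed.

(** * Covering the product set by dilates *)

(** Every [z] is hit by at least [d] of the indices in [Q], so by averaging some
    index hits at least the proportion [d / #Q] of the points still missed;
    adding such an index [J] times leaves at most [(1 - d / #Q) ^ J #Z] of them. *)
Lemma greedy_cover (I T : choiceType) (Q : {fset I}) (Z : {fset T})
    (e : I -> T -> bool) (d : nat) :
  (forall z, z \in Z -> d <= #|` [fset i in Q | e i z]|)%N ->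
  forall J : nat, exists X : {fset I}, [/\ X `<=` Q, (#|` X| <= J)%N &
    (#|` [fset z in Z | [forall i : X, ~~ e (val i) z]]| * #|` Q| ^ J <=
       #|` Z| * (#|` Q| - d) ^ J)%N].
Proof.
move=> deg; elim=> [|J [X [XQ leJ IH]]].
  exists fset0; split; rewrite ?fsub0set ?cardfs0 // !expn0 !muln1.
  by apply: fsubset_leq_card; apply/fsubsetP => z; rewrite inE => /andP[].
pose miss (Y : {fset I}) := [fset z in Z | [forall i : Y, ~~ e (val i) z]].
have missZ Y : miss Y `<=` Z by apply/fsubsetP => z; rewrite inE => /andP[].
set U := miss X.
pose hit i := [fset z in U | e i z].
have [Q0|/fset0Pn[i0 i0Q]] := eqVneq Q fset0.
  by exists X; split; rewrite ?(leqW leJ) // Q0 cardfs0 exp0n // muln0.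
have cardE (K : choiceType) (Y : {fset K}) (a : pred K) :
    #|` [fset y in Y | a y]| = (\sum_(y <- Y | a y) 1)%N.
  by rewrite card_fset_sum1 [RHS]big_fset_condE.
have [i iQ le_hit] : exists2 i, i \in Q & (#|` U| * d <= #|` hit i| * #|` Q|)%N.
  have sum_hit : (#|` U| * d <= \sum_(i <- Q) #|` hit i|)%N.
    under eq_bigr => i _ do rewrite cardE big_mkcond /=.
    rewrite exchange_big /= card_fset_sum1 big_distrl /= big_seq [X in (_ <= X)%N]big_seq.
    apply: leq_sum => z zU; rewrite mul1n -big_mkcond /= -cardE deg //.
    exact: (fsubsetP (missZ X)).
  have [//|/hasPn none] := boolP (has (fun i => #|` U| * d <= #|` hit i| * #|` Q|)%N Q).
    by case/hasP => i iQ h; exists i.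
  (* Otherwise every index hits less than the average, which the strict bounds,
     summed over [Q], contradict. *)
  exfalso; move: sum_hit; apply/negP; rewrite -ltnNge.
  have Qgt : (0 < #|` Q|)%N by rewrite cardfs_gt0; apply/fset0Pn; exists i0.
  rewrite -(ltn_pmul2r Qgt) big_distrl /=.
  have le_sum : (\sum_(i <- Q) (#|` hit i| * #|` Q|).+1 <= \sum_(i <- Q) #|` U| * d)%N.
    rewrite big_seq [X in (_ <= X)%N]big_seq; apply: leq_sum => i iQ.
    by rewrite ltnNge none.
  have sumQ c : (\sum_(i <- Q) c = #|` Q| * c)%N.
    by rewrite big_const_seq count_predT iter_addn_0 mulnC.
  move: le_sum; under eq_bigr => i _ do rewrite -addn1.
  rewrite big_split /= !sumQ muln1 mulnC => /(leq_trans _); apply.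
  by rewrite -addn1 leq_add2l.
exists (i |` X); split.
- by rewrite fsubUset fsub1set iQ.
- by rewrite cardfsU1; case: (_ \notin _); rewrite ?ltnS // (leq_trans leJ).
rewrite -/(miss _).
have -> : miss (i |` X) = U `\` hit i.
  apply/fsetP => z; rewrite !inE.
  apply/andP/andP => [[zZ /forallP h]|[+ /andP[zZ zX]]]; rewrite zZ.
    have := h [` fset1U1 i X] => /= /negPf ->; rewrite andbF; split=> //.
    by apply/forallP => j; exact: (h [` fset1Ur i (fsvalP j)]).
  rewrite zX /= => iz; split=> //.
  apply/forallP => -[j] /=; rewrite !inE => /orP[/eqP ->//|jX].
  by move/forallP: zX => /(_ [` jX]).
rewrite cardfsDS; last by apply/fsubsetP => z; rewrite inE => /andP[].
rewrite !expnS mulnA mulnBl.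
apply: (@leq_trans (#|` U| * (#|` Q| - d) * #|` Q| ^ J)).
  by rewrite leq_mul2r mulnBr leq_sub2l ?orbT.
by rewrite mulnAC [X in (_ <= X)%N]mulnCA mulnC leq_mul2l IH orbT.
Qed.

(** With more than [L ln #Z] greedy steps, fewer than [(1 - 1 / L) ^ J #Z < 1] points
    are missed, because [1 - 1 / L <= exp (- 1 / L)]. *)
Lemma fset_cover (R : realType) (I T : choiceType) (Q : {fset I}) (Z : {fset T})
    (e : I -> T -> bool) (d : nat) (L : R) :
  Z != fset0 -> (0 < d)%N ->
  (forall z, z \in Z -> d <= #|` [fset i in Q | e i z]|)%N ->
  0 < L -> #|` Q|%:R <= L * d%:R ->
  exists X : {fset I}, [/\ X `<=` Q, #|` X|%:R <= L * ln #|` Z|%:R + 1 :> R &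
    forall z, z \in Z -> exists2 i, i \in X & e i z].
Proof.
move=> Z0 dgt deg L0 leQ.
have Zgt : (0 < #|` Z|)%N by rewrite cardfs_gt0.
have lnZ : 0 <= ln #|` Z|%:R :> R by rewrite ln_ge0 // ler1n.
pose J := (Num.truncn (L * ln #|` Z|%:R : R)).+1.
have [X [XQ leJ miss]] := greedy_cover deg J.
have LlnZ : 0 <= L * ln #|` Z|%:R by rewrite mulr_ge0 // ltW.
have /andP[trunc_le lt_trunc] := truncn_itv LlnZ.
exists X; split=> //.
  by apply: (le_trans (_ : _ <= J%:R)); rewrite ?ler_nat // -natr1 lerD2r.
have [z0 z0Z] := fset0Pn _ Z0.
have le_dQ : (d <= #|` Q|)%N.
  apply: leq_trans (deg z0 z0Z) _; apply: fsubset_leq_card.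
  by apply/fsubsetP => i; rewrite inE => /andP[].
have Qgt : (0 < #|` Q|)%N by lia.
have small : (#|` Z| * (#|` Q| - d) ^ J < #|` Q| ^ J)%N.
  rewrite -(ltr_nat R) natrM !natrX natrB //.
  set q := #|` Q|%:R; set n := #|` Z|%:R.
  have q0 : 0 < q :> R by rewrite ltr0n.
  have n0 : 0 < n :> R by rewrite ltr0n.
  have step : q - d%:R <= q * expR (- L^-1).
    apply: (@le_trans _ _ (q * (1 - L^-1))).
      by rewrite mulrBr mulr1 lerD2l lerN2 ler_pdivrMr // mulrC.
    by rewrite ler_pM2l // expR_ge1Dx.
  have qd0 : 0 <= q - d%:R by rewrite subr_ge0 ler_nat.
  apply: (le_lt_trans (_ : _ <= n * (q * expR (- L^-1)) ^+ J)).
    by rewrite ler_pM2l // lerXn2r // nnegrE mulr_ge0 ?expR_ge0 // ltW.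
  rewrite exprMn mulrCA -[ltRHS]mulr1 ltr_pM2l ?exprn_gt0 //.
  rewrite -expRM_natl -[n]lnK ?posrE // -expRD -[ltRHS]expR0 ltr_expR.
  by rewrite mulrN subr_lt0 ltr_pdivlMr // mulrC.
move=> z zZ; have [/hasP[i iX ez]|/hasPn none] := boolP (has (e^~ z) X).
  by exists i.
exfalso; move: small; apply/negP; rewrite -leqNgt; apply: leq_trans miss.
rewrite leq_pmull // cardfs_gt0; apply/fset0Pn; exists z; rewrite inE.
by apply/andP; split=> //; apply/forallP => i; apply: none; exact: fsvalP.
Qed.

(** The dilates [xA] used have [x] in [AA/A]: the ones containing a given [z] in [AA]
    are those with [x = z / b], one for each [b] in [A]. *)
Lemma dilate_cover (R : realType) (F : fieldType) (A : {fset F}) (K : R) :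
  0 \notin A -> A != fset0 -> #|` prodset A A|%:R <= K * #|` A|%:R ->
  exists X : {fset F}, [/\ 0 \notin X,
     #|` X|%:R <= K ^+ 3 * ln #|` prodset A A|%:R + 1 &
     forall z, z \in prodset A A -> exists2 x, x \in X & z / x \in A].
Proof.
move=> A0 An0 leK.
have Agt : (0 < #|` A|)%N by rewrite cardfs_gt0.
have [a aA] := fset0Pn _ An0.
have AA0 : prodset A A != fset0 by apply/fset0Pn; exists (a * a); exact: mem_prodset.
have AAgt : (0 < #|` prodset A A|)%N by rewrite cardfs_gt0.
have A1 : 0 < #|` A|%:R :> R by rewrite ltr0n.
have K0 : 0 < K by rewrite -(pmulr_lgt0 _ A1) (lt_le_trans _ leK) // ltr0n.
have Qn0 : 0 \notin quotset (prodset A A) A.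
  apply/negP => /imfset2P[_ /prodsetP[x [y [xA yA ->]]] [z zA /esym/eqP]].
  rewrite mulf_eq0 invr_eq0 mulf_eq0.
  by case/orP => [/orP[]|] /eqP e; move: A0; rewrite -e ?xA ?yA ?zA.
have deg z : z \in prodset A A ->
    (#|` A| <= #|` [fset x in quotset (prodset A A) A | z / x \in A]|)%N.
  move=> zAA; have z0 : z != 0.
    move: zAA => /prodsetP[x [y [xA yA ->]]]; rewrite mulf_neq0 //.
      by apply: contraNneq A0 => <-.
    by apply: contraNneq A0 => <-.
  have inj : {in A &, injective (fun b => z / b)}.
    by move=> b c _ _ /(mulfI z0) /invr_inj.
  rewrite -(card_in_imfset imfset_key inj); apply: fsubset_leq_card.
  apply/fsubsetP => _ /imfsetP[b /= bA ->]; rewrite inE; apply/andP; split.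
    by apply/imfset2P; exists z => //; exists b.
  by rewrite invf_div mulrCA divff ?mulr1.
have leQ : #|` quotset (prodset A A) A|%:R <= K ^+ 3 * #|` A|%:R.
  rewrite -(ler_pM2r (exprn_gt0 2 A1)) -natrX -natrM.
  apply: (le_trans (_ : _ <= (#|` prodset A A| ^ 3)%:R)).
    by rewrite ler_nat plunnecke_ruzsa.
  rewrite natrX -mulrA natrX -exprS -exprMn lerXn2r ?nnegrE ?ler0n //.
  by rewrite mulr_ge0 ?ler0n // ltW.
have [X [XQ leX cov]] := fset_cover AA0 Agt deg (exprn_gt0 3 K0) leQ.
exists X; split=> //.
by apply: contra Qn0; exact: (fsubsetP XQ).
Qed.

(** * Popular differences *)

(** From [p = b - c] comes [p * a = a * b - a * c], and [a * b], [a * c] are rewritten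
    as elements of dilates of [A].  For [a = 0] this loses [b] and [c], but then
    the solutions [u * b - u * b = 0], with [u] in [X] fixed, are numerous
    enough. *)
Lemma rdiff_le_dilates (F : fieldType) (A X : {fset F}) (p a : F) :
  X != fset0 -> 0 \notin X -> a \in A ->
  (forall b, b \in A -> exists2 x, x \in X & a * b / x \in A) ->
  (rdiff A p <= \sum_(c : X * X) rdilate A (val c.1) (val c.2) (p * a))%N.
Proof.
move=> Xn0 X0 aA cov.
pose G := [pred t : (X * X) * (A * A) |
  val t.1.1 * val t.2.1 - val t.1.2 * val t.2.2 == p * a].
have -> : (\sum_(c : X * X) rdilate A (val c.1) (val c.2) (p * a))%N = #|G|.
  under eq_bigr => c _ do rewrite /rdilate -sum1_card.
  rewrite pair_big_dep /= -sum1_card; apply: eq_bigl => -[c w].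
  by rewrite !inE.
have [u0 u0X] := fset0Pn _ Xn0.
have rep (b : A) : exists u : X * A, a * val b == val u.1 * val u.2.
  have [x xX xA] := cov _ (fsvalP b).
  exists ([` xX], [` xA]); rewrite /= mulrCA divff ?mulr1 //.
  by apply: contraNneq X0 => <-.
pose h (w : A * A) : (X * X) * (A * A) :=
  if a == 0 then (([` u0X], [` u0X]), (w.1, w.1)) else
  (((xchoose (rep w.1)).1, (xchoose (rep w.2)).1),
   ((xchoose (rep w.1)).2, (xchoose (rep w.2)).2)).
have h_inj : {in [pred w : A * A | val w.1 - val w.2 == p] &, injective h}.
  move=> [b c] [b' c']; rewrite !inE /h /= => /eqP e /eqP e'.
  case: (a =P 0) => [_ [eb _]|/eqP a0 [e1 e2 e3 e4]].
    congr pair; first exact: eb.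
    by apply: val_inj; apply: oppr_inj; apply: (addrI (val b)); rewrite e {1}eb e'.
  have inj_rep (y y' : A) : (xchoose (rep y)).1 = (xchoose (rep y')).1 ->
      (xchoose (rep y)).2 = (xchoose (rep y')).2 -> y = y'.
    move=> f1 f2; apply: val_inj; apply: (mulfI a0).
    by rewrite (eqP (xchooseP (rep y))) (eqP (xchooseP (rep y'))) f1 f2.
  by rewrite (inj_rep b b') // (inj_rep c c').
rewrite rdiff_card -(card_in_imset h_inj); apply: subset_leq_card.
apply/subsetP => _ /imsetP[[b c] bc ->].
rewrite inE /h /=; have {bc}/eqP <- : val b - val c == p by move: bc; rewrite inE.
case: (a =P 0) => [->|_] /=; first by rewrite subrr mulr0.
rewrite -(eqP (xchooseP (rep b))) -(eqP (xchooseP (rep c))).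
by rewrite -mulrBr mulrC.
Qed.

(** The elements of [PA] are popular differences of [AA], which the dilates [xA]
    cover, so their number is controlled by the energy of that union. *)
Lemma popular_dilates (R : realType) (F : fieldType) (A X P : {fset F}) (k : nat)
    (Delta : R) :
  X != fset0 -> 0 \notin X -> (0 < k)%N -> 0 <= Delta ->
  (forall a b, a \in A -> b \in A -> exists2 x, x \in X & a * b / x \in A) ->
  (forall p, p \in P -> Delta <= (rdiff A p)%:R) ->
  #|` prodset P A|%:R * Delta ^+ k <= #|` X|%:R ^+ (2 * k) * (energy A k)%:R.
Proof.
move=> Xn0 X0 k0 D0 cov popP.
apply: le_trans (_ : _ <= (\sum_(z <- prodset P A)
  (\sum_(c : X * X) rdilate A (val c.1) (val c.2) z) ^ k)%:R) _; last first.
  by rewrite -natrX -natrM ler_nat cover_energy.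
rewrite card_fset_sum1 !natr_sum mulr_suml big_seq [leRHS]big_seq.
apply: ler_sum => _ /prodsetP[p [a [pP aA ->]]]; rewrite mul1r natrX.
rewrite lerXn2r ?nnegrE ?ler0n //; apply: le_trans (popP p pP) _.
by rewrite ler_nat rdiff_le_dilates // => b bA; exact: cov.
Qed.

(** Removing [0] from [A] at most halves it, so the set [B] of nonzero elements has
    [#BB <= 2 M #B] and is covered by at most [8 M ^ 3 ln #BB + 1] dilates, where
    [ln #BB <= 2 log #A] and [1 <= M ^ 3 log #A].  The resulting constant [17] is
    rounded up to a power of [2], so that its [2 k]-th power is a power of [2 ^ k].
    A product that vanishes lies in every dilate of [A]. *)
Lemma few_dilates (R : realType) (F : fieldType) (A : {fset F}) (M : R) :
  (2 <= #|` A|)%N -> #|` prodset A A|%:R <= M * #|` A|%:R ->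
  exists X : {fset F}, [/\ X != fset0, 0 \notin X,
    #|` X|%:R <= 2 ^+ 5 * M ^+ 3 * log2 (#|` A|%:R : R) &
    forall a b, a \in A -> b \in A -> exists2 x, x \in X & a * b / x \in A].
Proof.
move=> A2 leM; set n := #|` A|%:R : R.
have n2 : 2 <= n by rewrite ler_nat.
have n0 : 0 < n by lra.
pose B := A `\ 0.
have BA : B `<=` A by rewrite fsubD1set.
have cardB : (#|` A| <= #|` B|.+1)%N by rewrite (cardfsD1 0 A); case: (_ \in _).
have Bn0 : B != fset0 by rewrite -cardfs_gt0; lia.
have [u uB] := fset0Pn _ Bn0.
have /andP[u0 uA] : (u != 0) && (u \in A) by move: uB; rewrite !inE.
have M1 : 1 <= M.
  rewrite -(ler_pM2r n0) mul1r; apply: le_trans leM; rewrite ler_nat.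
  rewrite -(card_dilate A u0); apply: fsubset_leq_card.
  by apply/fsubsetP => _ /imfsetP[x /= xA ->]; exact: mem_prodset.
have leBB : #|` prodset B B|%:R <= (2 * M) * #|` B|%:R.
  apply: (le_trans (_ : _ <= M * n)).
    by apply: le_trans leM; rewrite ler_nat; apply: fsubset_leq_card; exact: prodsetSS.
  rewrite -mulrA mulrCA ler_pM2l ?(lt_le_trans ltr01) // -natrM ler_nat.
  lia.
have B0 : 0 \notin B by rewrite !inE eqxx.
have [X [X0 leX cov]] := dilate_cover B0 Bn0 leBB.
have [x0 x0X _] := cov _ (mem_prodset uB uB).
exists X; split=> //; first by apply/fset0Pn; exists x0.
  have ln2 : 0 < ln 2 :> R by rewrite ln_gt0 // ltr1n.
  have ln2_le1 : ln 2 <= 1 :> R by have := @le_ln1Dx R 1; rewrite -natr1; apply; lra.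
  have l1 : 1 <= log2 n.
    by rewrite /log2 ler_pdivlMr // mul1r ler_ln // posrE ltr0n.
  have lnB : ln #|` prodset B B|%:R <= 2 * log2 n.
    have BBgt : (0 < #|` prodset B B|)%N.
      by rewrite cardfs_gt0; apply/fset0Pn; exists (u * u); exact: mem_prodset.
    apply: (le_trans (_ : _ <= ln (n ^+ 2))).
      rewrite ler_ln ?posrE ?ltr0n ?exprn_gt0 // -natrX ler_nat -mulnn.
      apply: leq_trans (card_prodset_le _ _) _.
      by apply: leq_mul; apply: fsubset_leq_card.
    have : ln n <= log2 n by rewrite /log2 ler_pdivlMr // ler_piMr // ln_ge0 //; lra.
    by rewrite lnXn // mulr2n; lra.
  apply: (le_trans leX).
  have M3 : 1 <= M ^+ 3 by rewrite exprn_ege1.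
  have e : (2 * M) ^+ 3 = 8 * M ^+ 3 by rewrite exprMn; congr (_ * _); ring.
  have e5 : 2 ^+ 5 = 32 :> R by ring.
  rewrite e e5.
  have : M ^+ 3 * ln #|` prodset B B|%:R <= M ^+ 3 * (2 * log2 n).
    by rewrite ler_pM2l //; lra.
  have : 1 * 1 <= M ^+ 3 * log2 n by rewrite ler_pM.
  lra.
move=> a b aA bA; have [ab0|ab0] := eqVneq (a * b) 0.
  exists x0 => //; rewrite ab0 mul0r.
  by move/eqP: ab0; rewrite mulf_eq0 => /orP[] /eqP <-.
have [|x xX abx] := cov (a * b).
  by move: ab0; rewrite mulf_eq0 negb_or => /andP[a0 b0]; rewrite mem_prodset // !inE ?a0 ?b0.
by exists x => //; exact: (fsubsetP BA).
Qed.

Theorem mainTheorem2 (R : realType) (C0 c0 : R) (hC0 : 0 < C0) (hc0 : 0 < c0) :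
  exists C c : nat -> R,
    (forall k : nat, (1 <= k)%N -> 0 < C k /\ 0 < c k) /\
    (exists (K : R) (d : nat), forall k : nat, (1 <= k)%N ->
       C k <= K * (2 ^+ k) ^+ d /\ c k <= K * (2 ^+ k) ^+ d) /\
    forall (k : nat) (F : fieldType) (A P : {fset F}) (M Delta : R),
      (1 <= k)%N ->
      (2 <= #|` A|)%N ->
      #|` prodset A A|%:R <= M * #|` A|%:R ->
      0 < Delta ->
      P `<=` diffset A A ->
      (forall x : F, x \in P ->
         Delta <= (rdiff A x)%:R /\ (rdiff A x)%:R <= 2 * Delta) ->
      (energy A k)%:R <=
        C0 * (log2 #|` A|%:R) `^ c0 * \sum_(x <- P) (rdiff A x)%:R ^+ k ->
      #|` prodset P A|%:R <=
        C k * (log2 #|` A|%:R) `^ c k * M ^+ (6 * k) * #|` P|%:R.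
Proof.
(* Here [(2 ^ 5) ^ (2 k)] comes from the number of dilates and [2 ^ k] from the
   upper bound [2 * Delta] on the multiplicities. *)
exists (fun k => C0 * (2 ^+ k) ^+ 11), (fun k => c0 + (2 * k)%:R).
split; [|split].
- move=> k _; split; first by rewrite mulr_gt0 // !exprn_gt0.
  by rewrite ltr_wpDr // ler0n.
- exists (C0 + c0 + 2), 11%N => k k1.
  have p1 : 1 <= (2 ^+ k) ^+ 11 :> R by rewrite !exprn_ege1 // ler1n.
  have pk : k%:R <= (2 ^+ k) ^+ 11 :> R.
    rewrite -!natrX ler_nat -expnM (leq_trans (ltnW (ltn_expl k (isT : 1 < 2)%N))) //.
    by rewrite leq_exp2l //; lia.
  split; first by rewrite ler_pM2r; lra.
  by rewrite natrM; nra.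
move=> k F A P M Delta k1 A2 leM D0 _ popP leE.
have [X [Xn0 X0 leX cov]] := few_dilates A2 leM.
set l := log2 _ in leE leX *.
have l0 : 0 < l.
  by rewrite /l /log2 divr_gt0 // ln_gt0 // ltr1n.
clearbody l.
have sumP : \sum_(x <- P) (rdiff A x)%:R ^+ k <= #|` P|%:R * (2 * Delta) ^+ k.
  rewrite card_fset_sum1 natr_sum mulr_suml big_seq [leRHS]big_seq.
  apply: ler_sum => x /popP[_ le2]; rewrite mul1r.
  by rewrite lerXn2r // nnegrE ?ler0n // mulr_ge0 // ltW.
have Dk : 0 < Delta ^+ k by rewrite exprn_gt0.
rewrite -(ler_pM2r Dk).
apply: le_trans (popular_dilates Xn0 X0 k1 (ltW D0) cov (fun p pP => (popP p pP).1)) _.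
apply: (le_trans (_ : _ <= (2 ^+ 5 * M ^+ 3 * l) ^+ (2 * k) *
    (C0 * l `^ c0 * (#|` P|%:R * (2 * Delta) ^+ k)))).
  apply: ler_pM; rewrite ?exprn_ge0 ?ler0n //.
    rewrite lerXn2r // nnegrE ?ler0n //; exact: le_trans leX.
  apply: le_trans leE _; rewrite ler_pM2l //.
  by rewrite mulr_gt0 // powR_gt0.
have -> : l `^ (c0 + (2 * k)%:R) = l `^ c0 * l ^+ (2 * k).
  rewrite powRD; first by rewrite powR_mulrn // ltW.
  by rewrite (gt_eqF l0) implybT.
rewrite [(_ * l) ^+ _]exprMn [(2 ^+ 5 * _) ^+ _]exprMn [(2 * Delta) ^+ _]exprMn.
rewrite -!exprM le_eqVlt; apply/orP; left; apply/eqP.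
have -> : (3 * (2 * k) = 6 * k)%N by lia.
have -> : (k * 11 = 5 * (2 * k) + k)%N by lia.
rewrite (exprD 2); set u := 2 ^+ (5 * _); set v := M ^+ _; set w := l ^+ _; ring.
Qed.
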